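(* Let $T\ge 2$ be an integer and let $\mu>0$, $\sigma>0$, $-\frac{1}{T-1}<\rho<1$ satisfy $\mu^2+\rho\sigma^2>0$. Set $\theta=1+(T-1)\rho>0$ and let $\mathcal P$ be the ambiguity set defined in the context. For any $\gamma>0$ we have $$ \sup_{\mathbb P\in\mathcal P}\mathbb P\left(\sum_{t=1}^T\tilde\xi_t\le\gamma\right)=\begin{cases} 1 & \text{if } \gamma\ge T\mu,\\[1ex] \dfrac{T\sigma^2\theta}{T\sigma^2\theta+(\gamma-T\mu)^2} & \text{otherwise.} \end{cases} $$
   Context: Let $\boldsymbol\mu=\mu\boldsymbol 1\in\mathbb R^T$ and $\boldsymbol\Sigma=(1-\rho)\sigma^2\mathbb I+\rho\sigma^2\boldsymbol 1\boldsymbol 1^\intercal$, where $\mathbb I$ is the $T\times T$ identity matrix and $\boldsymbol 1$ the all-ones vector. $\mathcal P$ is the set of all Borel probability distributions $\mathbb P$ of a random vector $\tilde{\boldsymbol\xi}=(\tilde\xi_1,\dots,\tilde\xi_T)^\intercal$ supported on $\mathbb R^T_+$ with $\mathbb E_{\mathbb P}(\tilde{\boldsymbol\xi})=\boldsymbol\mu$ and $\mathbb E_{\mathbb P}(\tilde{\boldsymbol\xi}\tilde{\boldsymbol\xi}^\intercal)=\boldsymbol\Sigma+\boldsymbol\mu\boldsymbol\mu^\intercal$. *)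

(* Defs.v *)
From HB Require Import structures.
From mathcomp Require Import all_boot all_order all_algebra.
From mathcomp Require Import all_classical all_reals all_analysis.

Set Implicit Arguments.
Unset Strict Implicit.
Unset Printing Implicit Defensive.

Import Order.TTheory GRing.Theory Num.Theory.
Import numFieldNormedType.Exports.

Local Open Scope classical_set_scope.
Local Open Scope ring_scope.

(* R^T as column vectors, with the sigma-algebra generated by the open sets of
   the usual topology.  The instances of 'cV[R]_T other than the measurable one
   are not inherited, so functions of x : borel_vec T R are written with x
   explicitly typed in 'cV[R]_T. *)
Definition borel_vec (T : nat) (R : realType) :=
  g_sigma_algebraType (@open 'cV[R]_T).

Definition mean_vec (T : nat) (R : realType) (mu : R) : 'cV[R]_T :=
  mu *: const_mx 1.

Definition cov_mx (T : nat) (R : realType) (sigma rho : R) : 'M[R]_T :=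
  ((1 - rho) * sigma ^+ 2) *: 1%:M
  + (rho * sigma ^+ 2) *: (const_mx 1 *m (const_mx 1 : 'cV[R]_T)^T).

(* The random vector is the identity on R^T.  Moments are entrywise extended
   real expectations; no separate integrability clause is needed, because the
   integrands are almost surely nonnegative on the support and their integrals
   are required to be finite. *)
Definition ambiguity_set (T : nat) (R : realType) (m : 'cV[R]_T) (S : 'M[R]_T) :
    set (probability (borel_vec T R) R) :=
  [set P : probability (borel_vec T R) R |
   [/\ P [set x : 'cV[R]_T | forall t, 0 <= x t 0] = 1%E,
     forall t, 'E_P[fun x : 'cV[R]_T => x t 0%R]%E = (m t 0)%:E &
     forall s t, 'E_P[fun x : 'cV[R]_T => ((x *m x^T) s t)%R]%E
       = ((S + m *m m^T) s t)%:E]].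

(* Main.v *)
(* The coordinate sum S has mean n mu and variance v = n sigma^2 theta, so
   Cantelli's inequality gives the upper bound.  For gamma < n mu it is attained:
   let S follow Cantelli's extremal law on {gamma, n mu + v / (n mu - gamma)},
   which is nonnegative since gamma > 0, and given S = s put x at the diagonal
   point (s/n, ..., s/n) with probability lambda and at a uniformly chosen vertex
   s e_i otherwise.  By exchangeability only E[x_i x_j] remains to be matched; the
   required lambda lies in [0, 1] exactly because rho <= 1 and
   mu^2 + rho sigma^2 >= 0.  For gamma >= n mu apply the construction to
   n mu - eps and let eps tend to 0. *)
Require Import Defs.
From HB Require Import structures.
From mathcomp Require Import all_boot all_order all_algebra.
From mathcomp Require Import all_classical all_reals all_analysis.
From mathcomp Require Import measurable_realfun ring lra.

Set Implicit Arguments.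
Unset Strict Implicit.
Unset Printing Implicit Defensive.

Import Order.TTheory GRing.Theory Num.Theory.
Import numFieldNormedType.Exports.

Local Open Scope classical_set_scope.
Local Open Scope ring_scope.

(** * Borel measurability of coordinates, their sum and the orthant *)

Section BorelVec.
Context (R : realType) (n : nat).
Implicit Types (x : 'cV[R]_n) (g : R).

Lemma continuous_measurable_borel_vec (f : 'cV[R]_n -> R) :
  continuous f -> measurable_fun setT (f : borel_vec n R -> R).
Proof.
move=> cf; apply: (measurability _ (RGenOpens.measurableE R)).
move=> _ [_ [a [b ->] <-]].
apply: sub_sigma_algebra; rewrite setTI.
by move: cf => /continuousP; apply; exact: interval_open.
Qed.

Lemma measurable_coord (t : 'I_n) :
  measurable_fun setT ((fun x : 'cV[R]_n => x t 0) : borel_vec n R -> R).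
Proof. by apply: continuous_measurable_borel_vec => x; exact: coord_continuous. Qed.

Lemma measurable_coord_sum :
  measurable_fun setT ((fun x => \sum_t x t 0) : borel_vec n R -> R).
Proof. by apply: measurable_sum => t; exact: measurable_coord. Qed.

Lemma measurable_coord_sum_le g :
  measurable ([set x | \sum_t x t 0 <= g] : set (borel_vec n R)).
Proof.
rewrite -[X in measurable X]setTI.
have := measurable_coord_sum measurableT (measurable_itv `]-oo, g]).
by congr (measurable (_ `&` _)); apply/seteqP; split => x; rewrite /= in_itv.
Qed.

Lemma measurable_orthant :
  measurable ([set x | forall t, 0 <= x t 0] : set (borel_vec n R)).
Proof.
have -> : ([set x | forall t, 0 <= x t 0] : set (borel_vec n R)) =
    \bigcap_(t in [set: 'I_n]) [set x : 'cV[R]_n | 0 <= x t 0].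
  by apply/seteqP; split => x /= => [H t _|H t]; exact: H.
apply: (@fin_bigcap_measurable _ (borel_vec n R)) => // t _.
rewrite -[X in measurable X]setTI.
have := @measurable_coord t measurableT _ (measurable_itv `[0, +oo[).
by congr (measurable (_ `&` _)); apply/seteqP; split => x; rewrite /= in_itv/= andbT.
Qed.

End BorelVec.

(** * Square-integrable variables and the lower-tail Cantelli inequality *)

Section Moments.
Context d (T : measurableType d) (R : realType) (P : probability T R).

Lemma expectation_fin_sum (I : finType) (X : I -> T -> R) :
  (forall i, X i \in Lfun P 1) ->
  'E_P[fun x => (\sum_i X i x)%R]%E = (\sum_i 'E_P[X i])%E.
Proof.
move=> X1; transitivity 'E_P[(\sum_(Y <- [seq X i | i <- index_enum I]) Y)%R]%E.
  congr ('E_P[_])%E; apply/funext => x.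
  by rewrite big_map fct_sumE.
rewrite expectation_sum ?big_map// => Y /mapP[i _ ->]; exact: X1.
Qed.

Lemma Lfun2_of_sqr_expectation (X : T -> R) :
  measurable_fun setT X -> ('E_P[(X \* X)%R] < +oo)%E -> X \in Lfun P 2%:E.
Proof.
move=> mX EX; rewrite inE; apply/andP; split; rewrite inE//=.
rewrite /finite_norm unlock /Lnorm poweR_lty//.
move: EX; rewrite unlock.
rewrite (_ : (fun x => _) = (fun x : T => (`|(EFin \o X) x| `^ 2)%E)) //.
apply/funext => x /=.
by rewrite powR_mulrn// real_normK ?num_real// expr2.
Qed.

(** The upper-tail Cantelli inequality is applied to [\- X] with deviation [m - g]; negation
    preserves the variance, which is [v]. *)
Lemma cantelli_left (X : T -> R) (m v g : R) :
  X \in Lfun P 2%:E -> 'E_P[X]%E = m%:E -> 'E_P[(X \* X)%R]%E = (v + m ^+ 2)%:E ->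
  g < m -> (P [set x | (X x <= g)%R] <= (v / (v + (g - m) ^+ 2))%:E)%E.
Proof.
move=> X2 EX EXX gm.
have N2 : \- X \in Lfun P 2%:E by rewrite rpredN// lee1n.
pose Y : {mfun T >-> R} := mfun_Sub (sub_Lfun_mfun N2).
have mg : 0 < m - g by rewrite subr_gt0.
have := @cantelli _ _ _ P Y _ N2 mg.
have X1 := Lfun_subset12 (fin_num_measure P _ measurableT) X2.
have -> : ('E_P[Y] = - m%:E)%E.
  rewrite (_ : (Y : T -> R) = \-X) //.
  have := @expectationZl _ _ _ P X (-1) X1.
  rewrite EX -EFinM mulN1r EFinN => <-.
  by congr ('E_P[_])%E; apply/funext => x /=; rewrite mulrN1.
have -> : fine ('V_P[Y])%E = v.
  rewrite (_ : (Y : T -> R) = \-X) //.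
  rewrite varianceN// varianceE// EX (_ : X ^+ 2 = X \* X)%R.
    by rewrite EXX /= addrK.
  by apply/funext => x; rewrite /= expr2.
set A := [set x | _]; set B := [set x | _].
rewrite (_ : A = B); first by rewrite -exprnP -sqrrN opprB.
apply/seteqP; rewrite /A /B; split => x /=; rewrite ?lee_fin => ?; lra.
Qed.

End Moments.

(** * Finitely supported probability measures *)

Section FiniteProbability.
Context d (T : measurableType d) (R : realType) (I : finType).
Variables (w : I -> R) (w_ge0 : forall i, 0 <= w i) (p : I -> T).

(** [msum] adds a sequence indexed by [nat], so the atoms are enumerated; the default [i0] is never
    reached for [k < #|I|]. *)
Let m (i0 : I) (k : nat) : {measure set T -> \bar R} :=
  mscale (NngNum (w_ge0 (nth i0 (enum I) k))) (dirac (p (nth i0 (enum I) k))).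

Let big_nth_enum (V : nmodType) (i0 : I) (F : I -> V) :
  \sum_(k < #|I|) F (nth i0 (enum I) k) = \sum_i F i.
Proof.
rewrite -(big_mkord xpredT (fun k => F (nth i0 (enum I) k))) -[RHS]big_enum.
by rewrite (big_nth i0) -cardE.
Qed.

Let ge0_integral_atoms i0 (f : T -> R) : measurable_fun setT f ->
  (forall x, 0 <= f x) ->
  (\int[msum (m i0) #|I|]_x (f x)%:E = (\sum_i w i * f (p i))%R%:E)%E.
Proof.
move=> mf f0; have mEf := (measurable_EFinP setT f).2 mf.
have Ef0 x : setT x -> (0 <= (f x)%:E)%E by rewrite lee_fin.
rewrite (ge0_integral_measure_sum _ measurableT Ef0 mEf).
rewrite -(big_nth_enum i0) -sumEFin; apply: eq_bigr => k _.
rewrite (ge0_integral_mscale _ measurableT _ mEf Ef0).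
by rewrite (integral_dirac _ measurableT mEf)/= diracT mul1e EFinM.
Qed.

Lemma finite_probability_exists : \sum_i w i = 1 ->
  exists P : probability T R, forall f : T -> R, measurable_fun setT f ->
    'E_P[f]%E = (\sum_i w i * f (p i))%:E.
Proof.
move=> w1; have i0 : I.
  case: (pickP (fun _ : I => true)) => [//|I0].
  by move: w1; rewrite big_pred0// => /esym/eqP; rewrite oner_eq0.
pose mu := msum (m i0) #|I|.
have mu1 : mu setT = 1%E.
  rewrite -w1 -(big_nth_enum i0) -sumEFin; apply: eq_bigr => k _.
  by rewrite /= /mscale/= diracT mule1.
pose isP := @Measure_isProbability.Build _ _ _ (msum (m i0) #|I|) mu1.
pose P : probability T R := HB.pack (msum (m i0) #|I|) isP.
exists P => f mf; rewrite unlock.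
have -> : (\int[P]_x (f x)%:E = \int[mu]_x (f x)%:E)%E by [].
(* The atomic formula holds for nonnegative functions, so it is applied to the positive and negative
   parts of [f]. *)
rewrite integralE (funerpos f) (funerneg f).
rewrite !ge0_integral_atoms//.
- rewrite -EFinB -sumrB; congr EFin; apply: eq_bigr => i _.
  by rewrite -mulrBr -[in RHS](funrposBneg f).
- exact: measurable_funrneg.
- exact: measurable_funrpos.
Qed.

End FiniteProbability.

(** * Lifting a law of the coordinate sum to the orthant *)

Section SimplexLift.
Context (R : realType) (n : nat).
Variables (J : finType) (q s : J -> R) (a c : R).
Hypotheses (n_gt0 : (0 < n)%N) (q_ge0 : forall j, 0 <= q j) (s_ge0 : forall j, 0 <= s j)
  (c_ge0 : 0 <= c) (ca : c <= a) (a_gt0 : 0 < a).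
Hypotheses (q1 : \sum_j q j = 1)
  (qss : \sum_j q j * s j ^+ 2 = n%:R * a + n%:R * (n%:R - 1) * c).

(* Mixing weight of the diagonal point (s/n, ..., s/n); the vertices s e_i of the
   simplex share 1 - lambda.  The off-diagonal second moments, which the vertices
   do not charge, force this value, and c <= a gives lambda <= 1. *)
Let lambda : R := n%:R ^+ 2 * c / (n%:R * a + n%:R * (n%:R - 1) * c).

(** The index [ord0] stands for the diagonal point and [lift ord0 i] for the vertex in direction
    [i]. *)
Let weight (jk : J * 'I_n.+1) : R :=
  q jk.1 * (if unlift ord0 jk.2 is Some _ then (1 - lambda) / n%:R else lambda).

Let atom (jk : J * 'I_n.+1) : 'cV[R]_n :=
  if unlift ord0 jk.2 is Some i then s jk.1 *: delta_mx i 0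
  else const_mx (s jk.1 / n%:R).

Let sum_atoms (F : 'cV[R]_n -> R) :
  \sum_jk weight jk * F (atom jk) =
  \sum_j q j * (lambda * F (const_mx (s j / n%:R)) +
     (1 - lambda) / n%:R * \sum_i F (s j *: delta_mx i 0)).
Proof.
rewrite -(pair_bigA _ (fun j k => weight (j, k) * F (atom (j, k)))) /=.
apply: eq_bigr => j _; rewrite big_ord_recl /weight /atom /= unlift_none.
rewrite mulrDr !mulrA; congr (_ + _).
rewrite [RHS]mulr_sumr; apply: eq_bigr => i _.
by rewrite liftK /= !mulrA.
Qed.

Let n0 : n%:R != 0 :> R.
Proof. by rewrite pnatr_eq0 -lt0n. Qed.

Let n1 : 1 <= n%:R :> R.
Proof. by rewrite ler1n. Qed.

Let den_gt0 : 0 < n%:R * a + n%:R * (n%:R - 1) * c.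
Proof.
apply: ltr_wpDr; first by rewrite !mulr_ge0// subr_ge0.
by rewrite mulr_gt0// ltr0n.
Qed.

Let lambda_ge0 : 0 <= lambda.
Proof. by rewrite divr_ge0 ?mulr_ge0// ?exprn_ge0// ltW. Qed.

Let lambda_le1 : lambda <= 1.
Proof.
rewrite ler_pdivrMr// mul1r.
(* After clearing the denominator and cancelling, the claim is [n * c <= n * a]. *)
have := ler_wpM2l (ler0n R n) ca; nra.
Qed.

Let weight_ge0 jk : 0 <= weight jk.
Proof.
rewrite /weight mulr_ge0//; case: unlift => // _.
by rewrite divr_ge0// subr_ge0.
Qed.

Let sum_delta j i : \sum_t (s j *: delta_mx i 0 : 'cV[R]_n) t 0 = s j.
Proof.
rewrite (bigD1 i)//= !mxE !eqxx mulr1 big1 ?addr0// => t ti.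
by rewrite !mxE (negPf ti) mulr0.
Qed.

Let sum_const j : \sum_t (const_mx (s j / n%:R) : 'cV[R]_n) t 0 = s j.
Proof.
under eq_bigr do rewrite mxE.
by rewrite sumr_const card_ord -[LHS]mulr_natr divfK.
Qed.

(** If [F] takes one value on all atoms over the same [j], the mixing weights add up to 1 and
    [lambda] disappears. This covers total mass, support and the tail. *)
Let sum_atoms_cst (F : 'cV[R]_n -> R) (G : J -> R) :
  (forall j, F (const_mx (s j / n%:R)) = G j) ->
  (forall j i, F (s j *: delta_mx i 0) = G j) ->
  \sum_jk weight jk * F (atom jk) = \sum_j q j * G j.
Proof.
move=> FG1 FG2; rewrite sum_atoms; apply: eq_bigr => j _.
rewrite FG1 (eq_bigr (fun=> G j)) ?sumr_const ?card_ord//.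
by rewrite -mulr_natr; congr (_ * _); field.
Qed.

(** The hypothesis [qss] is the compatibility condition: the second moment of the sum must equal the
    total of [n] diagonal moments [a] and [n * (n - 1)] off-diagonal moments [c]. *)
Lemma simplex_lift : exists P : probability (borel_vec n R) R,
  [/\ P [set x | forall t, 0 <= x t 0] = 1%E,
    forall t, 'E_P[fun x : 'cV[R]_n => x t 0%R]%E = ((\sum_j q j * s j) / n%:R)%:E,
    forall t u, 'E_P[fun x : 'cV[R]_n => (x t 0 * x u 0)%R]%E
      = (if t == u then a else c)%:E &
    forall g, P [set x | \sum_t x t 0 <= g] = (\sum_(j | s j <= g) q j)%:E].
Proof.
have w1 : \sum_jk weight jk = 1.
  have := sum_atoms_cst (F := fun=> 1) (G := fun=> 1) (fun=> erefl) (fun _ _ => erefl).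
  under eq_bigr do rewrite mulr1.
  by under [RHS]eq_bigr do rewrite mulr1; rewrite q1.
have [P EP] := @finite_probability_exists _ (borel_vec n R) R _ _ weight_ge0 atom w1.
exists P; split.
- rewrite -(expectation_indic _ (@measurable_orthant R n)) EP.
    rewrite (sum_atoms_cst (G := fun=> 1)).
    + by under eq_bigr do rewrite mulr1; rewrite q1.
    + move=> j; rewrite indicE mem_set//= => t; rewrite mxE divr_ge0//.
    + move=> j i; rewrite indicE mem_set//= => t.
      by rewrite !mxE mulr_ge0.
  by apply: measurable_indic; exact: measurable_orthant.
- move=> t; rewrite EP ?(sum_atoms (fun x => x t 0)); last exact: measurable_coord.
  rewrite mulr_suml; congr EFin; apply: eq_bigr => j _ /=.
  rewrite mxE (bigD1 t)//= !mxE !eqxx mulr1 big1 ?addr0; last first.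
    by move=> i it; rewrite !mxE eq_sym (negPf it) mulr0.
  by field.
- move=> t u; rewrite EP ?(sum_atoms (fun x => x t 0 * x u 0)); last first.
    by apply: measurable_funM; exact: measurable_coord.
  (* The diagonal point contributes to every pair of coordinates, the vertices only to [t == u]. *)
  transitivity ((\sum_j q j * s j ^+ 2) * (lambda / n%:R ^+ 2 +
      (1 - lambda) / n%:R * (t == u)%:R))%:E.
    rewrite mulr_suml; congr EFin; apply: eq_bigr => j _.
    rewrite !mxE (bigD1 t)//= !mxE !eqxx mulr1 big1 ?addr0; last first.
      by move=> i it; rewrite !mxE eq_sym (negPf it) mulr0 mul0r.
    by rewrite andbT eq_sym; field.
  rewrite qss; congr EFin; set M := (X in X * _).
  (* Off the diagonal this leaves [c]; on it, [M - n ^ 2 * c = n * (a - c)] adds the missing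
     [a - c]. *)
  have lM : lambda * M = n%:R ^+ 2 * c by rewrite divfK// gt_eqF.
  rewrite (_ : _ * _ = lambda * M / n%:R ^+ 2 +
    (M - lambda * M) / n%:R * (t == u)%:R); last by field.
  by rewrite lM /M; case: eqP => _ /=; field.
- move=> g; rewrite -(expectation_indic _ (measurable_coord_sum_le g)) EP.
    rewrite (sum_atoms_cst (G := fun j => (s j <= g)%R%:R)).
    + congr EFin; rewrite [RHS]big_mkcond; apply: eq_bigr => j _.
      by case: ifP => _; rewrite ?mulr1 ?mulr0.
    + move=> j; rewrite indicE -[in RHS](sum_const j); congr _%:R.
      by congr nat_of_bool; apply/idP/idP; rewrite inE.
    + move=> j i; rewrite indicE -[in RHS](sum_delta j i); congr _%:R.
      by congr nat_of_bool; apply/idP/idP; rewrite inE.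
  by apply: measurable_indic; exact: measurable_coord_sum_le.
Qed.

End SimplexLift.

Lemma mean_vecE (R : realType) (n : nat) (mu : R) t :
  mean_vec n mu t 0 = mu.
Proof. by rewrite !mxE mulr1. Qed.

Lemma second_moment_mxE (R : realType) (n : nat) (mu sigma rho : R) s t :
  (cov_mx n sigma rho + mean_vec n mu *m (mean_vec n mu)^T) s t =
  if s == t then mu ^+ 2 + sigma ^+ 2 else mu ^+ 2 + rho * sigma ^+ 2.
Proof. by rewrite !mxE !big_ord1 !mxE /=; case: eqP => _ /=; ring. Qed.

Lemma outer_productE (R : realType) (n : nat) (x : 'cV[R]_n) s t :
  (x *m x^T) s t = x s 0 * x t 0.
Proof. by rewrite mxE big_ord1 mxE. Qed.

(** * The tail bound over the ambiguity set and its attainment *)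

Section AmbiguitySet.
Context (R : realType) (n : nat) (mu sigma rho : R).
Hypotheses (n_ge2 : (2 <= n)%N) (mu_gt0 : 0 < mu) (sigma_gt0 : 0 < sigma)
  (rho_gt : - (1 / (n%:R - 1)) < rho) (rho_lt1 : rho < 1)
  (moment_gt0 : 0 < mu ^+ 2 + rho * sigma ^+ 2).

Lemma variance_coord_sum_gt0 :
  0 < n%:R * sigma ^+ 2 * (1 + (n%:R - 1) * rho).
Proof.
have n_ge2R : 2 <= n%:R :> R by rewrite (ler_nat _ 2).
have n1 : 0 < n%:R - 1 :> R by rewrite subr_gt0 (lt_le_trans _ n_ge2R)// ltr1n.
rewrite !mulr_gt0 ?exprn_gt0//.
  by rewrite (lt_le_trans _ n_ge2R).
by move: rho_gt; rewrite -mulNr ltr_pdivrMr// => ?; lra.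
Qed.

Let P_set := ambiguity_set (mean_vec n mu) (cov_mx n sigma rho).
Let v : R := n%:R * sigma ^+ 2 * (1 + (n%:R - 1) * rho).

Let v_gt0 : 0 < v := variance_coord_sum_gt0.

Lemma ambiguity_tail_le (P : probability (borel_vec n R) R) g :
  P_set P -> g < n%:R * mu ->
  (P [set x : 'cV[R]_n | (\sum_t x t 0 <= g)%R] <=
    (v / (v + (g - n%:R * mu) ^+ 2))%:E)%E.
Proof.
move=> [_ EP EPP] gm.
pose X t : borel_vec n R -> R := fun x : 'cV[R]_n => x t 0.
have mX t : measurable_fun setT (X t) by exact: measurable_coord.
have EX t : 'E_P[X t]%E = mu%:E by rewrite EP mean_vecE.
have EXX s t : 'E_P[(X s \* X t)%R]%E =
    (if s == t then mu ^+ 2 + sigma ^+ 2 else mu ^+ 2 + rho * sigma ^+ 2)%:E.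
  rewrite -second_moment_mxE -EPP; congr ('E_P[_])%E.
  by apply/funext => x; rewrite outer_productE.
(* Finiteness of the diagonal second moments supplies the integrability behind the linearity of
   expectation. *)
have X2 t : X t \in Lfun P 2%:E.
  by apply: Lfun2_of_sqr_expectation; rewrite ?EXX ?ltry.
have X1 t : X t \in Lfun P 1.
  exact: (Lfun_subset12 (fin_num_measure P _ measurableT)).
have -> : [set x : 'cV[R]_n | (\sum_t x t 0 <= g)%R] =
  [set x : borel_vec n R | ((\sum_t X t) x <= g)%R].
  by apply/seteqP; split => x; rewrite /= fct_sumE.
apply: cantelli_left => //.
- by rewrite rpred_sum// lee1n.
- rewrite (_ : \sum_t X t = fun x => \sum_t X t x); last first.
    by apply/funext => x; rewrite fct_sumE.
  rewrite expectation_fin_sum//.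
  under eq_bigr do rewrite EX.
  by rewrite sumEFin sumr_const card_ord -[mu *+ n]mulr_natl.
- rewrite (_ : _ \* _ = fun x => \sum_st (X st.1 \* X st.2) x); last first.
    apply/funext => x; rewrite /= fct_sumE mulr_suml.
    rewrite -(pair_bigA _ (fun s t => X s x * X t x)) /=.
    by apply: eq_bigr => s _; rewrite mulr_sumr.
  rewrite expectation_fin_sum; last by move=> st; exact: Lfun2_mul_Lfun1.
  under eq_bigr do rewrite EXX.
  rewrite sumEFin; congr EFin.
  rewrite -(pair_bigA _ (fun s t : 'I_n => if s == t then mu ^+ 2 + sigma ^+ 2
    else mu ^+ 2 + rho * sigma ^+ 2))/=.
  (* Each row has one diagonal entry and [n - 1] equal off-diagonal ones. *)
  under eq_bigr => s _.
    rewrite (bigD1 s)//= eqxx.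
    under eq_bigr => t ts do rewrite eq_sym (negPf ts).
    rewrite sumr_const cardC1 card_ord.
    over.
  rewrite sumr_const card_ord -[LHS]mulr_natl -[X in _ + X]mulr_natl.
  rewrite -subn1 natrB; last exact: ltnW.
  by rewrite /v; ring.
Qed.

(** The value [g = 0] is included because the limiting argument for large [gamma] may call for
    it. *)
Lemma ambiguity_tail_attained g : 0 <= g -> g < n%:R * mu ->
  exists2 P, P_set P &
    P [set x : 'cV[R]_n | \sum_t x t 0 <= g] =
    (v / (v + (g - n%:R * mu) ^+ 2))%:E.
Proof.
move=> g0 gm; pose d := n%:R * mu - g; have d0 : 0 < d by rewrite subr_gt0.
have vd0 : 0 < v + d ^+ 2 by rewrite addr_gt0// exprn_gt0.
(* The deviations from the mean are [- d] for [true] and [v / d] for [false]; these weights make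
   their mean 0 and their variance [v]. *)
pose q (b : bool) := if b then v / (v + d ^+ 2) else d ^+ 2 / (v + d ^+ 2).
pose s (b : bool) := if b then g else n%:R * mu + v / d.
have vd : 0 < v / d by rewrite divr_gt0.
have d_neq0 : d != 0 by rewrite gt_eqF.
have vd_neq0 : v + d ^+ 2 != 0 by rewrite gt_eqF.
have gE : g = n%:R * mu - d by rewrite /d; ring.
have := @simplex_lift R n bool q s (mu ^+ 2 + sigma ^+ 2) (mu ^+ 2 + rho * sigma ^+ 2).
case.
- exact: ltnW.
- by case; rewrite /q divr_ge0 ?exprn_ge0// ltW.
- by case; rewrite /s//; lra.
- exact: ltW.
- by rewrite lerD2l ger_pMl ?exprn_gt0// ltW.
- by rewrite addr_gt0// exprn_gt0.
- by rewrite big_bool /q /= -mulrDl divff.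
- rewrite big_bool /= {1}gE.
  transitivity (v + (n%:R * mu) ^+ 2); last by rewrite /v; ring.
  by field; rewrite d_neq0.
move=> P [P0 EP EPP Pg]; exists P.
  split => // [t|t u].
    rewrite mean_vecE EP big_bool /= {1}gE; congr EFin.
    by field; rewrite d_neq0 vd_neq0 pnatr_eq0 -lt0n ltnW.
  rewrite second_moment_mxE -EPP; congr ('E_P[_])%E.
  by apply/funext => x; rewrite outer_productE.
rewrite Pg big_mkcond big_bool /= lexx ifF ?addr0.
  by rewrite /d -sqrrN opprB.
apply/negbTE; rewrite -ltNge; lra.
Qed.

End AmbiguitySet.

Theorem theorem6p3 (R : realType) (T : nat) (mu sigma rho gamma : R)
    (hT : (2 <= T)%N) (hmu : 0 < mu) (hsigma : 0 < sigma)
    (hrho_lb : - (1 / (T%:R - 1)) < rho) (hrho_ub : rho < 1)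
    (hpos : 0 < mu ^+ 2 + rho * sigma ^+ 2) (hgamma : 0 < gamma) :
  let theta := 1 + (T%:R - 1) * rho in
  ereal_sup [set P [set x : 'cV[R]_T | \sum_(t < T) x t 0 <= gamma]
            | P in ambiguity_set (mean_vec T mu) (cov_mx T sigma rho)]
  = (if T%:R * mu <= gamma then 1
     else T%:R * sigma ^+ 2 * theta
          / (T%:R * sigma ^+ 2 * theta + (gamma - T%:R * mu) ^+ 2))%:E.
Proof.
move=> theta.
case: ifPn => [mg|]; last first.
  rewrite -ltNge => gm; apply/le_anti/andP; split.
    by apply: ge_ereal_sup => _ [P AP <-]; exact: ambiguity_tail_le.
  have [P AP PE] :=
    ambiguity_tail_attained hT hmu hsigma hrho_lb hrho_ub hpos (ltW hgamma) gm.
  by apply: ereal_sup_ubound; exists P.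
apply/le_anti/andP; split.
  apply: ge_ereal_sup => _ [P AP <-].
  exact: probability_le1 (measurable_coord_sum_le gamma).
apply/lee_subgt0Pr => e e0.
have T0 : 0 < T%:R :> R by rewrite ltr0n ltnW.
set v := T%:R * sigma ^+ 2 * theta.
have v0 : 0 < v by exact: variance_coord_sum_gt0.
(* The first bound keeps the threshold [T * mu - eps] nonnegative; the other two give
   [eps ^ 2 <= eps <= v * e], hence [v / (v + eps ^ 2) >= 1 - e]. *)
pose eps := Num.min (T%:R * mu) (Num.min 1 (v * e)).
have eps0 : 0 < eps by rewrite /eps !lt_min ltr01 (mulr_gt0 T0 hmu) (mulr_gt0 v0 e0).
have eps1 : eps <= T%:R * mu by rewrite /eps ge_min lexx.
have eps2 : eps ^+ 2 <= v * e.
  rewrite (@le_trans _ _ eps)//; last by rewrite /eps !ge_min lexx !orbT.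
  by rewrite expr2 ger_pMl// /eps !ge_min lexx orbT.
have [||P AP PE] := ambiguity_tail_attained hT hmu hsigma hrho_lb hrho_ub hpos
  (g := T%:R * mu - eps).
- by rewrite subr_ge0.
- by rewrite ltrBlDr ltrDl.
apply: (@le_trans _ _ (P [set x : 'cV[R]_T | \sum_t x t 0 <= gamma])); last first.
  by apply: ereal_sup_ubound; exists P.
apply: (@le_trans _ _ (P [set x : 'cV[R]_T | \sum_t x t 0 <= T%:R * mu - eps])); last first.
  apply: le_measure; rewrite ?inE; [exact: measurable_coord_sum_le..|].
  by move=> x /= /le_trans; apply; lra.
rewrite PE -EFinB lee_fin addrAC subrr sub0r sqrrN -/v.
rewrite ler_pdivlMr; last by rewrite addr_gt0// exprn_gt0.
nra.
Qed.
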